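(* Let $n\ge m$ be positive integers and let $f:\mathbb{R}^{m\times n}\to\mathbb{R}$ satisfy the standing assumptions listed in the context, including a global Polyak-Łojasiewicz inequality with constant $\mu>0$. Consider the preconditioned heavy-ball iteration $$H_k=\beta H_{k-1}+(1-\beta)\nabla f(x_{k-1}),\qquad x_k=x_{k-1}-\alpha P_k^{-1}H_k,\qquad k\ge 1,$$ where the preconditioners $P_k\in\mathbb{R}^{m\times m}$ are symmetric positive definite and uniformly bounded, i.e. there are constants $p_{\max}>p_{\min}>0$ such that $p_{\min}I\preceq P_k\preceq p_{\max}I$ for all $k$. Then there exist $\beta^\star\in(0,1)$ and a positive function $\alpha^\star:[0,\beta^\star)\to\mathbb{R}_{>0}$ such that for every $\beta\in[0,\beta^\star)$ and every $\alpha\in(0,\alpha^\star(\beta))$ the generated sequence satisfies $\lim_{k\to\infty}\|\nabla f(x_k)\|=0$ and, moreover, there exist constants $C>0$ and $\rho\in(0,1)$ such that $$f(x_k)-f^\star\le C\rho^k\qquad\text{for all }k\in\mathbb{N}.$$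
   Context: $\|\cdot\|$ and $\langle\cdot,\cdot\rangle$ denote the Frobenius norm and inner product on matrices, $\nabla f$ is the gradient with respect to this inner product, and $\preceq$ is the Loewner order. Standing assumptions on $f$: $f$ is differentiable and $L$-smooth for some $L>0$, i.e. $\|\nabla f(x)-\nabla f(y)\|\le L\|x-y\|$ for all $x,y$; $f$ is proper, meaning that preimages of compact sets are compact; $f$ is bounded below and attains its minimum value $f^\star$ at some finite point. The global Polyak-Łojasiewicz inequality with constant $\mu>0$ means $\|\nabla f(x)\|^2\ge\mu(f(x)-f^\star)$ for all $x\in\mathbb{R}^{m\times n}$. Conventions: $\alpha>0$ is the learning rate, $\beta\in[0,1)$ the momentum parameter; the matrices $P_k$ may vary with $k$ and may depend on the iterates; the bounds $p_{\min},p_{\max}$ are fixed before $\beta^\star$ and $\alpha^\star$, which may depend on $p_{\min},p_{\max}$ and $L$. The iteration starts from an initial pair $(x_0,H_0)\in\mathbb{R}^{m\times n}\times\mathbb{R}^{m\times n}$. The constants $C$ and $\rho$ may depend on the initial pair, $\alpha$ and $\beta$. *)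

(* Defs.v *)
From HB Require Import structures.
From mathcomp Require Import all_boot all_order all_algebra.
From mathcomp Require Import all_classical all_reals all_analysis.
Set Implicit Arguments.
Unset Strict Implicit.
Unset Printing Implicit Defensive.
Import Order.TTheory GRing.Theory Num.Theory.
Import numFieldNormedType.Exports.
Local Open Scope classical_set_scope.
Local Open Scope ring_scope.

Definition frob_inner (R : realType) (m n : nat) (A B : 'M[R]_(m, n)) : R :=
  \tr (A^T *m B).

(* The library's norm on ['M[R]_(m, n)] is the entrywise maximum; it induces
   the same topology, but [L]-smoothness and the Polyak-Lojasiewicz inequality
   are stated with the norm below. *)
Definition frob_norm (R : realType) (m n : nat) (A : 'M[R]_(m, n)) : R :=
  Num.sqrt (frob_inner A A).

(* The Riesz representative of ['d f x] for [frob_inner] when [f] is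
   differentiable at [x]: see [grad_diff] and [grad_unique]. *)
Definition grad (R : realType) (m n : nat) (f : 'M[R]_(m, n) -> R)
    (x : 'M[R]_(m, n)) : 'M[R]_(m, n) :=
  \matrix_(i, j) 'D_(delta_mx i j) f x.

Lemma frob_innerE (R : realType) (m n : nat) (A B : 'M[R]_(m, n)) :
  frob_inner A B = \sum_i \sum_j A i j * B i j.
Proof.
rewrite /frob_inner /mxtrace exchange_big /=; apply: eq_bigr => j _.
by rewrite mxE; apply: eq_bigr => i _; rewrite mxE.
Qed.

Lemma grad_diff (R : realType) (m n : nat) (f : 'M[R]_(m, n) -> R)
    (x h : 'M[R]_(m, n)) :
  differentiable f x -> 'd f x h = frob_inner (grad f x) h.
Proof.
move=> df; rewrite frob_innerE [in LHS](matrix_sum_delta h) linear_sum.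
apply: eq_bigr => i _; rewrite linear_sum; apply: eq_bigr => j _.
by rewrite linearZ /= mxE deriveE // mulrC.
Qed.

Lemma grad_unique (R : realType) (m n : nat) (f : 'M[R]_(m, n) -> R)
    (x G : 'M[R]_(m, n)) :
  differentiable f x -> (forall h, 'd f x h = frob_inner G h) -> G = grad f x.
Proof.
move=> df dG; apply/matrixP => i j; rewrite mxE deriveE // dG frob_innerE.
rewrite (bigD1 i) //= (bigD1 j) //= mxE !eqxx mulr1 !big1 ?addr0 //.
- by move=> k ki; rewrite big1 // => l _; rewrite mxE (negbTE ki) mulr0.
- by move=> l lj; rewrite mxE (negbTE lj) andbF mulr0.
Qed.

Definition L_smooth (R : realType) (m n : nat) (L : R)
    (f : 'M[R]_(m, n) -> R) : Prop :=
  forall x y, frob_norm (grad f x - grad f y) <= L * frob_norm (x - y).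

Definition proper_fun (R : realType) (m n : nat)
    (f : 'M[R]_(m, n) -> R) : Prop :=
  forall K : set R, compact K -> compact (f @^-1` K).

Definition attains_min (R : realType) (m n : nat)
    (f : 'M[R]_(m, n) -> R) (fstar : R) : Prop :=
  (forall x, fstar <= f x) /\ exists x, f x = fstar.

Definition PL_ineq (R : realType) (m n : nat) (mu : R)
    (f : 'M[R]_(m, n) -> R) (fstar : R) : Prop :=
  forall x, mu * (f x - fstar) <= frob_norm (grad f x) ^+ 2.

Definition sym_mx (R : realType) (m : nat) (P : 'M[R]_m) : Prop := P^T = P.

Definition posdef_mx (R : realType) (m : nat) (P : 'M[R]_m) : Prop :=
  forall v : 'cV[R]_m, v != 0 -> 0 < (v^T *m P *m v) 0 0.

(* Only meant for symmetric arguments. *)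
Definition loewner_le (R : realType) (m : nat) (A B : 'M[R]_m) : Prop :=
  forall v : 'cV[R]_m, 0 <= (v^T *m (B - A) *m v) 0 0.

(* [H 0] and [x 0] are the arbitrary initial pair; [P 0] is never used. *)
Definition heavy_ball (R : realType) (m n : nat) (alpha beta : R)
    (f : 'M[R]_(m, n) -> R) (P : nat -> 'M[R]_m)
    (x H : nat -> 'M[R]_(m, n)) : Prop :=
  forall k : nat,
    H k.+1 = beta *: H k + (1 - beta) *: grad f (x k) /\
    x k.+1 = x k - alpha *: (invmx (P k.+1) *m H k.+1).

(* Main.v *)
Require Import Defs.
From HB Require Import structures.
From mathcomp Require Import all_boot all_order all_algebra.
From mathcomp Require Import all_classical all_reals all_analysis.
From mathcomp Require Import ring lra.
Import Order.TTheory GRing.Theory Num.Theory.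
Import numFieldNormedType.Exports.
Local Open Scope classical_set_scope.
Local Open Scope ring_scope.
Set Implicit Arguments.
Unset Strict Implicit.
Unset Printing Implicit Defensive.

(** Everything is measured by the Lyapunov function
    [V_k = (f x_k - fstar) + alpha |H_k - grad f x_k|^2 / (2 pmin)], where
    [H_k - grad f x_k] is the momentum error, i.e. how far the averaged
    gradient lags behind the true one.

    With [d = P^-1 H_{k+1}] the step is [- alpha d].  The gradient at [x_k] is
    [H_{k+1}] up to [beta] times the momentum error, so the descent lemma
    ([descent_lemma]) makes [f] decrease by about [alpha <H_{k+1}, d>], minus a
    Young remainder in that error.  The bounds on [P] make this
    decrease dominate both [alpha pmin |d|^2] ([loewner_ge_frob]), which pays
    for every term quadratic in the step, and [alpha |H_{k+1}|^2 / pmax]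
    ([loewner_le_sqr]), which is the progress measured by the gradient.  The
    momentum error in turn is contracted by [beta] and perturbed by the change
    of the gradient, at most [L alpha |d|].  For [beta < 1/2] and
    [alpha < pmin / (4 L)] these balance ([lyapunov_step]):
    [V_{k+1} + alpha / (16 pmax) |grad f x_k|^2] is at most [f x_k - fstar]
    plus [13/16] of the momentum part of [V_k].

    The Polyak-Lojasiewicz inequality turns the gradient term into a fixed
    fraction of the function gap, so [V] decays geometrically
    ([lyapunov_contraction]); [mu] affects the rate only, not the thresholds on
    [alpha] and [beta].  The same estimate bounds [|grad f x_k|^2] by a multiple
    of [V_k], hence the gradient tends to [0]. *)

(** * The Frobenius inner product *)

Lemma frob_innerC (R : realType) (m n : nat) (A B : 'M[R]_(m, n)) :
  frob_inner A B = frob_inner B A.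
Proof. by rewrite /frob_inner -mxtrace_tr trmx_mul trmxK. Qed.

Lemma frob_innerDr (R : realType) (m n : nat) (A B C : 'M[R]_(m, n)) :
  frob_inner A (B + C) = frob_inner A B + frob_inner A C.
Proof. by rewrite /frob_inner mulmxDr mxtraceD. Qed.

Lemma frob_innerZr (R : realType) (m n : nat) (a : R) (A B : 'M[R]_(m, n)) :
  frob_inner A (a *: B) = a * frob_inner A B.
Proof. by rewrite /frob_inner -scalemxAr mxtraceZ. Qed.

Lemma frob_innerDl (R : realType) (m n : nat) (A B C : 'M[R]_(m, n)) :
  frob_inner (A + B) C = frob_inner A C + frob_inner B C.
Proof. by rewrite !(frob_innerC _ C) frob_innerDr. Qed.

Lemma frob_innerZl (R : realType) (m n : nat) (a : R) (A B : 'M[R]_(m, n)) :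
  frob_inner (a *: A) B = a * frob_inner A B.
Proof. by rewrite !(frob_innerC _ B) frob_innerZr. Qed.

Lemma frob_innerNr (R : realType) (m n : nat) (A B : 'M[R]_(m, n)) :
  frob_inner A (- B) = - frob_inner A B.
Proof. by rewrite -scaleN1r frob_innerZr mulN1r. Qed.

Lemma frob_innerNl (R : realType) (m n : nat) (A B : 'M[R]_(m, n)) :
  frob_inner (- A) B = - frob_inner A B.
Proof. by rewrite !(frob_innerC _ B) frob_innerNr. Qed.

Definition frob_inner_bilinE :=
  (frob_innerDl, frob_innerDr, frob_innerNl, frob_innerNr,
   frob_innerZl, frob_innerZr).

Lemma frob_inner_ge0 (R : realType) (m n : nat) (A : 'M[R]_(m, n)) :
  0 <= frob_inner A A.
Proof.
by rewrite frob_innerE; do 2!apply: sumr_ge0 => ? _; rewrite -expr2 sqr_ge0.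
Qed.

Lemma frob_norm_sqr (R : realType) (m n : nat) (A : 'M[R]_(m, n)) :
  frob_norm A ^+ 2 = frob_inner A A.
Proof. by rewrite sqr_sqrtr // frob_inner_ge0. Qed.

Lemma frob_inner_young (R : realType) (m n : nat) (c : R)
    (A B : 'M[R]_(m, n)) :
  0 < c ->
  frob_inner A B <= c / 2 * frob_inner A A + frob_inner B B / (2 * c).
Proof.
move=> c0; have := frob_inner_ge0 (c *: A - B).
rewrite !frob_inner_bilinE (frob_innerC B A) => h.
rewrite -(ler_pM2l (_ : 0 < 2 * c)); last by rewrite mulr_gt0.
rewrite mulrDr [2 * c * (_ / _)]mulrC divfK; last by rewrite mulf_neq0 ?gt_eqF.
lra.
Qed.

Lemma frob_inner_sqrD (R : realType) (m n : nat) (A B : 'M[R]_(m, n)) :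
  frob_inner (A + B) (A + B) <= 2 * frob_inner A A + 2 * frob_inner B B.
Proof.
have := frob_inner_ge0 (A - B).
by rewrite !frob_inner_bilinE (frob_innerC B A); lra.
Qed.

Lemma L_smooth_sqr (R : realType) (m n : nat) (L : R)
    (f : 'M[R]_(m, n) -> R) (x y : 'M[R]_(m, n)) :
  L_smooth L f ->
  frob_inner (grad f x - grad f y) (grad f x - grad f y)
    <= L ^+ 2 * frob_inner (x - y) (x - y).
Proof.
move=> Lf; rewrite -!frob_norm_sqr -exprMn ler_pXn2r ?nnegrE ?sqrtr_ge0 //.
exact: le_trans (sqrtr_ge0 _) (Lf x y).
Qed.

(** * The descent lemma *)

Lemma is_derive_line (R : realType) (m n : nat) (f : 'M[R]_(m, n) -> R)
    (x h : 'M[R]_(m, n)) (t : R) :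
  differentiable f (x + t *: h) ->
  is_derive t 1 (fun s => f (x + s *: h)) (frob_inner (grad f (x + t *: h)) h).
Proof.
move=> df; pose l : R -> 'M[R]_(m, n) := cst x + *:%R^~ h.
have dl : is_diff t l (0 + *:%R^~ h) by apply: is_diffD.
have dlt : differentiable f (l t) by [].
have dfP := differentiableP dlt.
have dc : is_diff t (f \o l) ('d f (l t) \o (0 + *:%R^~ h)).
  exact: is_diff_comp.
have dfl : differentiable (f \o l) t by exact: ex_diff.
split; first exact: (diff_derivable dfl).
rewrite -[LHS]/('D_1 (f \o l) t) deriveE // diff_val /=.
by rewrite -grad_diff // /l !fctE add0r scale1r.
Qed.

(** Along the segment from [x] to [x + h], the excess of [f] over its quadratic
    upper model has derivative [<grad f (x + t h) - grad f x, h> - L t |h|^2],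
    which is nonpositive: Young's inequality with weight [1 / (L t)] turns the
    Lipschitz bound on the gradient into exactly [L t |h|^2]. *)
Lemma descent_lemma (R : realType) (m n : nat) (L : R)
    (f : 'M[R]_(m, n) -> R) (x h : 'M[R]_(m, n)) :
  0 < L -> (forall y, differentiable f y) -> L_smooth L f ->
  f (x + h) <= f x + frob_inner (grad f x) h + L / 2 * frob_inner h h.
Proof.
move=> L0 df Lf.
pose a := frob_inner (grad f x) h; pose b := frob_inner h h.
pose phi : R -> R :=
  (fun t => f (x + t *: h)) - ((a *: id) + ((L / 2 * b) *: id ^+ 2)).
pose dphi t := frob_inner (grad f (x + t *: h)) h - (a + L * t * b).
have dphiP (t : R) : is_derive t 1 phi (dphi t).
  have dl := is_derive_line (df (x + t *: h)).
  have dq : is_derive t 1 ((a *: id) + ((L / 2 * b) *: (id : R -> R) ^+ 2))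
      (a *: 1 + (L / 2 * b) *: ((2%:R * t ^+ 1) *: 1)).
    apply: is_deriveD; apply: is_deriveZ; exact: is_deriveX.
  apply: (is_derive_eq (is_deriveB dl dq)).
  rewrite /dphi /GRing.scale /=; congr (_ - _).
  rewrite expr1 mulr1; lra.
have [|c /andP[c0 c1]] :=
    @MVT _ phi dphi 0 1 ltr01 (fun t _ => dphiP t).
  apply: continuous_subspaceT => t.
  by apply/differentiable_continuous/derivable1_diffP; case: (dphiP t).
rewrite !bnd_simp in c0 c1.
rewrite subr0 mulr1 => phiE.
have {phiE} : f (x + 1 *: h) - (a * 1 + L / 2 * b * 1 ^+ 2)
    - (f (x + 0 *: h) - (a * 0 + L / 2 * b * 0 ^+ 2)) = dphi c by [].
rewrite /dphi scale1r scale0r addr0 expr1n expr0n /= {dphiP phi dphi}.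
suff : frob_inner (grad f (x + c *: h)) h <= a + L * c * b by lra.
have Lc : 0 < L * c by rewrite mulr_gt0.
have := @frob_inner_young _ _ _ (L * c)^-1 (grad f (x + c *: h) - grad f x) h.
rewrite invr_gt0 => /(_ Lc).
have := L_smooth_sqr (x + c *: h) x Lf.
rewrite [x + _ - x]addrAC subrr add0r frob_innerZl frob_innerZr -/b.
set G := frob_inner (_ - _) (_ - _) => GL.
rewrite frob_innerDl frob_innerNl -/a.
have -> : b / (2 * (L * c)^-1) = L * c * b / 2.
  by field; rewrite ?(gt_eqF L0) ?(gt_eqF c0).
have : (L * c)^-1 * G <= L * c * b by rewrite ler_pdivrMl //; lra.
lra.
Qed.

(** * Preconditioners *)

Lemma posdef_unitmx (R : realType) (m : nat) (P : 'M[R]_m) :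
  sym_mx P -> posdef_mx P -> P \in unitmx.
Proof.
move=> sP pP; rewrite unitmxE unitfE; apply/negP => /det0P[v v0 vP].
have := pP v^T; rewrite trmxK vP mul0mx mxE ltxx => h.
by apply: notF; apply: h; rewrite -trmx0 (inj_eq trmx_inj).
Qed.

(** The columns of [A] can be tested against [M] one at a time, so that the
    quadratic form of [M] on [R^m] controls the one on matrices. *)
Lemma frob_inner_mulmx_ge0 (R : realType) (m n : nat) (M : 'M[R]_m)
    (A : 'M[R]_(m, n)) :
  (forall v : 'cV[R]_m, 0 <= (v^T *m M *m v) 0 0) ->
  0 <= frob_inner A (M *m A).
Proof.
move=> M0; rewrite /frob_inner mulmxA; apply: sumr_ge0 => j _.
have := M0 (col j A).
by rewrite tr_col -row_mul colE mulmxA -row_mul -colE mxE mxE.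
Qed.

Lemma loewner_ge_frob (R : realType) (m n : nat) (p : R) (P : 'M[R]_m)
    (d : 'M[R]_(m, n)) :
  loewner_le p%:M P -> p * frob_inner d d <= frob_inner d (P *m d).
Proof.
move=> /(@frob_inner_mulmx_ge0 _ _ n _ d).
by rewrite mulmxBl mul_scalar_mx !frob_inner_bilinE subr_ge0.
Qed.

Lemma loewner_le_frob (R : realType) (m n : nat) (p : R) (P : 'M[R]_m)
    (d : 'M[R]_(m, n)) :
  loewner_le P p%:M -> frob_inner d (P *m d) <= p * frob_inner d d.
Proof.
move=> /(@frob_inner_mulmx_ge0 _ _ n _ d).
by rewrite mulmxBl mul_scalar_mx !frob_inner_bilinE subr_ge0.
Qed.

(** This is [P^2 <= p P], obtained without diagonalising [P]: expand the
    nonnegative quadratic form of [P] at [d - P d / p]. *)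
Lemma loewner_le_sqr (R : realType) (m n : nat) (p : R) (P : 'M[R]_m)
    (d : 'M[R]_(m, n)) :
  0 < p -> sym_mx P -> loewner_le 0%:M P -> loewner_le P p%:M ->
  frob_inner (P *m d) (P *m d) <= p * frob_inner d (P *m d).
Proof.
move=> p0 sP P0 Pp.
have symP (A B : 'M[R]_(m, n)) : frob_inner (P *m A) B = frob_inner A (P *m B).
  by rewrite /frob_inner trmx_mul sP mulmxA.
have := loewner_ge_frob (p *: d - P *m d) P0.
have := loewner_le_frob (P *m d) Pp.
rewrite mul0r mulmxBr -scalemxAr !frob_inner_bilinE !symP => le_P h.
by rewrite -subr_ge0 -(pmulr_rge0 _ p0); lra.
Qed.

(** * The Lyapunov function *)

(** The real arithmetic behind [lyapunov_step].  There [a] and [b] are the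
    learning rate and the momentum parameter, [F] and [F'] the values of the
    objective before and after the step, [E], [E'], [g], [hh], [dd] the squared
    norms of the two momentum errors, the gradient, the new momentum and the
    direction [d], and [hd], [ed] the inner products of the momentum and of the
    old error with [d].

    In the units [e = a E / pmin], [D = a pmin dd] and [h = a hd], the decrease
    is [h] and every remainder is an explicit multiple of [e], [D] or [h].
    Since [D <= h], the remainders cost at most
    [(1/8 + 1/2 + 1/16 + 1/8) h < h] and
    [(1/8 + 1/4 + 1/32) e = 13/16 * (e / 2)]. *)
Lemma lyapunov_scalar (R : realType) (L pmin pmax a b : R)
    (F F' E E' g hd hh ed dd : R) :
  0 < pmin -> pmin < pmax -> 0 < L -> 0 < a -> L * a <= pmin / 4 ->
  0 <= b <= 1 / 2 -> 0 <= E -> 0 <= dd ->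
  F' <= F - a * (hd - b * ed) + L / 2 * (a ^+ 2 * dd) ->
  b * ed <= b ^+ 2 * E / (2 * pmin) + pmin / 2 * dd ->
  pmin * dd <= hd -> hh <= pmax * hd ->
  E' <= 2 * (b ^+ 2 * E) + 2 * (L ^+ 2 * (a ^+ 2 * dd)) ->
  g <= 2 * hh + 2 * (b ^+ 2 * E) ->
  F' + a * E' / (2 * pmin) + a / (16 * pmax) * g
    <= F + 13 / 16 * (a * E / (2 * pmin)).
Proof.
move=> pm0 pmM L0 a0 La /andP[b0 b1] E0 dd0 HF Hed Hdd Hhh HE Hg.
have pM0 : 0 < pmax by lra.
have bb : b ^+ 2 <= 1 / 4 by nra.
pose e := a * E / pmin; pose D := a * (pmin * dd); pose h := a * hd.
have e0 : 0 <= e by rewrite divr_ge0 ?mulr_ge0 // ltW.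
have D0 : 0 <= D by rewrite !mulr_ge0 // ltW.
have bbe : b ^+ 2 * e <= 1 / 4 * e by exact: ler_wpM2r.
have Dh : D <= h by rewrite ler_pM2l.
have F1 : L / 2 * (a ^+ 2 * dd) <= D / 8.
  have : (L * a) * (a * dd) <= pmin / 4 * (a * dd).
    by apply: ler_wpM2r => //; rewrite mulr_ge0 // ltW.
  by rewrite /D; lra.
have F2 : a * (b * ed) <= e / 8 + D / 2.
  have : a * (b * ed) <= a * (b ^+ 2 * E / (2 * pmin) + pmin / 2 * dd).
    by rewrite ler_pM2l.
  have -> : a * (b ^+ 2 * E / (2 * pmin) + pmin / 2 * dd)
            = b ^+ 2 * e / 2 + D / 2.
    by rewrite /e /D; field; lra.
  lra.
have F3 : a * E' / (2 * pmin) <= e / 4 + D / 16.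
  have : a * E' / (2 * pmin)
      <= a * (2 * (b ^+ 2 * E) + 2 * (L ^+ 2 * (a ^+ 2 * dd))) / (2 * pmin).
    by rewrite ler_pM2r ?invr_gt0 ?mulr_gt0 // ler_pM2l.
  have -> : a * (2 * (b ^+ 2 * E) + 2 * (L ^+ 2 * (a ^+ 2 * dd))) / (2 * pmin)
            = b ^+ 2 * e + (L * a / pmin) ^+ 2 * D.
    by rewrite /e /D; field; lra.
  have : (L * a / pmin) ^+ 2 * D <= 1 / 16 * D.
    apply: ler_wpM2r => //.
    have : L * a / pmin <= 1 / 4 by rewrite ler_pdivrMr //; lra.
    have : 0 <= L * a / pmin by rewrite divr_ge0 ?mulr_ge0 // ltW.
    by move: (L * a / pmin) => z; nra.
  lra.
have F4 : a / (16 * pmax) * g <= h / 8 + e / 32.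
  have : a / (16 * pmax) * g
      <= a / (16 * pmax) * (2 * (pmax * hd) + 2 * (b ^+ 2 * E)).
    by rewrite ler_pM2l ?divr_gt0 ?mulr_gt0 //; lra.
  have -> : a / (16 * pmax) * (2 * (pmax * hd) + 2 * (b ^+ 2 * E))
            = h / 8 + b ^+ 2 * (a * E / pmax) / 8.
    by rewrite /h; field; lra.
  have : b ^+ 2 * (a * E / pmax) <= b ^+ 2 * e.
    rewrite ler_wpM2l ?sqr_ge0 // ler_wpM2l ?mulr_ge0 ?(ltW a0) //.
    by rewrite lef_pV2 ?posrE // ltW.
  lra.
have -> : a * E / (2 * pmin) = e / 2 by rewrite /e; field; lra.
have : F' <= F - h + a * (b * ed) + L / 2 * (a ^+ 2 * dd) by rewrite /h; lra.
lra.
Qed.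

(** One iteration.  Writing the momentum as gradient plus error, the new error
    before the gradient moves is [beta] times the old one, which is what makes
    the estimate close up. *)
Lemma lyapunov_step (R : realType) (m n : nat) (L pmin pmax alpha beta : R)
    (f : 'M[R]_(m, n) -> R) (P : 'M[R]_m) (x H x' H' : 'M[R]_(m, n)) :
  0 < L -> 0 < pmin -> pmin < pmax ->
  (forall y, differentiable f y) -> L_smooth L f ->
  0 <= beta <= 1 / 2 -> 0 < alpha -> L * alpha <= pmin / 4 ->
  sym_mx P -> posdef_mx P -> loewner_le pmin%:M P -> loewner_le P pmax%:M ->
  H' = beta *: H + (1 - beta) *: grad f x ->
  x' = x - alpha *: (invmx P *m H') ->
  f x' + alpha * frob_inner (H' - grad f x') (H' - grad f x') / (2 * pmin)
    + alpha / (16 * pmax) * frob_inner (grad f x) (grad f x)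
  <= f x
    + 13 / 16 * (alpha * frob_inner (H - grad f x) (H - grad f x) / (2 * pmin)).
Proof.
move=> L0 pm0 pmM df Lf b01 a0 La sP pP Pmin Pmax eH ex.
set g := grad f x in eH *; set g' := grad f x'.
pose E := H - g; pose d := invmx P *m H'.
have HPd : H' = P *m d by rewrite mulKVmx // posdef_unitmx.
have gE : g = H' - beta *: E.
  by rewrite eH scalerBl scale1r scalerBr; apply/matrixP => i j; rewrite !mxE; ring.
have P0 : loewner_le 0%:M P.
  (* [posdef_mx] excludes [v = 0], which is treated apart. *)
  move=> v; rewrite raddf0 subr0; have [->|v0] := eqVneq v 0.
    by rewrite mulmx0 mxE.
  exact/ltW/pP.
have Hx : x' = x + - alpha *: d by rewrite ex scaleNr.
have HE' : H' - g' = beta *: E + (g - g').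
  by rewrite gE; apply/matrixP => i j; rewrite !mxE; ring.
have xx' : x - x' = alpha *: d by rewrite Hx scaleNr opprB addrC subrK.
apply: (@lyapunov_scalar _ L pmin pmax alpha beta _ _
  (frob_inner E E) (frob_inner (H' - g') (H' - g')) _
  (frob_inner H' d) (frob_inner H' H') (frob_inner E d) (frob_inner d d)) => //.
- exact: frob_inner_ge0.
- exact: frob_inner_ge0.
- have := @descent_lemma _ _ _ L f x (- alpha *: d) L0 df Lf.
  rewrite -Hx -/g !frob_innerZr !frob_innerZl.
  rewrite [in X in frob_inner X d]gE !frob_inner_bilinE.
  by move=> h; lra.
- have := @frob_inner_young _ _ _ pmin^-1 (beta *: E) d.
  rewrite invr_gt0 => /(_ pm0); rewrite !frob_innerZl frob_innerZr => h.
  apply: le_trans h _; rewrite le_eqVlt; apply/orP; left; apply/eqP.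
  by field; lra.
- by rewrite frob_innerC HPd loewner_ge_frob.
- rewrite (frob_innerC _ d) [in X in X <= _]HPd [in X in _ <= X]HPd.
  by rewrite loewner_le_sqr //; lra.
- rewrite HE'; apply: le_trans (frob_inner_sqrD _ _) _.
  rewrite !frob_innerZl !frob_innerZr; apply: lerD; first by lra.
  have := L_smooth_sqr x x' Lf.
  rewrite xx' !frob_innerZl !frob_innerZr -/g -/g'; lra.
- rewrite gE; apply: le_trans (frob_inner_sqrD _ _) _.
  by rewrite !frob_inner_bilinE -/E; lra.
Qed.

(** * Geometric decay *)

(** The gradient term left over in [lyapunov_step] dominates
    [alpha mu / (16 pmax)] times the function gap by the Polyak-Lojasiewicz
    inequality (here [c = alpha / (16 pmax)], [F] the gap, [G] the squared
    gradient norm), while the momentum part [e] already carries the factor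
    [13/16]: any [r] above both factors contracts [F + e].  The bound on [G]
    follows because [F + e] stays nonnegative after each step. *)
Lemma lyapunov_contraction (R : realType) (F G e : nat -> R) (c mu r : R) :
  0 < c -> 13 / 16 <= r -> 1 - c * mu <= r ->
  (forall k, 0 <= F k) -> (forall k, 0 <= e k) ->
  (forall k, mu * F k <= G k) ->
  (forall k, F k.+1 + e k.+1 + c * G k <= F k + 13 / 16 * e k) ->
  forall k, F k + e k <= (F 0 + e 0) * r ^+ k /\
            c * G k <= (F 0 + e 0) * r ^+ k.
Proof.
move=> c0 r13 rmu F0 e0 PL step.
suff decay k : F k + e k <= (F 0 + e 0) * r ^+ k.
  move=> k; split=> //; apply: le_trans (decay k).
  by have := step k; have := F0 k.+1; have := e0 k.+1; have := e0 k; lra.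
elim: k => [|k IH]; first by rewrite expr0 mulr1.
rewrite exprSr mulrA; apply: le_trans (ler_wpM2r _ IH); last by lra.
have cPL : c * (mu * F k) <= c * G k by rewrite ler_pM2l.
have rF : (1 - c * mu) * F k <= r * F k by exact: ler_wpM2r.
have re : 13 / 16 * e k <= r * e k by exact: ler_wpM2r.
by have := step k; lra.
Qed.

Lemma geometric_sqr_cvg0 (R : realType) (u : nat -> R) (K r : R) :
  0 <= r < 1 -> (forall k, u k ^+ 2 <= K * r ^+ k) -> u @ \oo --> 0.
Proof.
move=> /andP[r0 r1] uK.
have sq0 : (fun k => u k ^+ 2) @ \oo --> 0.
  apply: (@squeeze_cvgr _ _ _ _ (cst 0) (fun k => K * r ^+ k)).
  - by near=> k; rewrite sqr_ge0 uK.
  - exact: cvg_cst.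
  - rewrite -[X in _ --> X](mulr0 K); apply: cvgMr.
    by apply: cvg_expr; rewrite ger0_norm.
apply: norm_cvg0.
under eq_fun do rewrite -sqrtr_sqr.
rewrite -sqrtr0.
by apply: (continuous_cvg _ (@sqrt_continuous R 0) sq0).
Unshelve. all: by end_near.
Qed.

(** * Linear convergence of the preconditioned heavy-ball method *)

Theorem corollary1 (R : realType) (m n : nat) (m_gt0 : (0 < m)%N)
    (le_mn : (m <= n)%N) (L pmin pmax : R) (L_gt0 : 0 < L)
    (pmin_gt0 : 0 < pmin) (pmin_lt_pmax : pmin < pmax) :
  exists (betastar : R) (alphastar : R -> R),
    [/\ 0 < betastar, betastar < 1,
        (forall beta, 0 <= beta < betastar -> 0 < alphastar beta)
      & forall (f : 'M[R]_(m, n) -> R) (fstar mu : R),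
        (forall x, differentiable f x) ->
        L_smooth L f ->
        proper_fun f ->
        attains_min f fstar ->
        0 < mu ->
        PL_ineq mu f fstar ->
        forall (alpha beta : R),
        0 <= beta < betastar ->
        0 < alpha < alphastar beta ->
        forall (P : nat -> 'M[R]_m) (x H : nat -> 'M[R]_(m, n)),
        (forall k, (0 < k)%N ->
           [/\ sym_mx (P k), posdef_mx (P k),
               loewner_le pmin%:M (P k) & loewner_le (P k) pmax%:M]) ->
        heavy_ball alpha beta f P x H ->
        frob_norm (grad f (x k)) @[k --> \oo] --> 0 /\
        exists C rho : R,
          [/\ 0 < C, 0 < rho < 1
            & forall k : nat, f (x k) - fstar <= C * rho ^+ k]].
Proof.
exists (1 / 2), (fun=> pmin / (4 * L)).
have pmax_gt0 : 0 < pmax by lra.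
split; [lra | lra | by move=> *; rewrite divr_gt0 ?mulr_gt0 | ].
move=> f fstar mu df Lf _ [f_ge _] mu_gt0 PL alpha beta /andP[b0 b1].
move=> /andP[a0 a1] P x H Pbd hb.
have La : L * alpha <= pmin / 4.
  by move: a1; rewrite invfM mulrA ltr_pdivlMr // => /ltW; lra.
pose sqn (A : 'M[R]_(m, n)) := frob_inner A A.
pose F k := f (x k) - fstar; pose G k := sqn (grad f (x k)).
pose e k := alpha * sqn (H k - grad f (x k)) / (2 * pmin).
(* The maximum keeps the rate positive when [c * mu] is at least [1]. *)
pose c := alpha / (16 * pmax); pose r := Num.max (13 / 16) (1 - c * mu).
have c0 : 0 < c by rewrite divr_gt0 ?mulr_gt0.
have F0 k : 0 <= F k by rewrite subr_ge0.
have e0 k : 0 <= e k.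
  by rewrite divr_ge0 ?mulr_ge0 ?frob_inner_ge0 // ltW.
have r0 : 13 / 16 <= r by rewrite le_max lexx.
have r1 : r < 1.
  by have := mulr_gt0 c0 mu_gt0; rewrite gt_max; lra.
have step k : F k.+1 + e k.+1 + c * G k <= F k + 13 / 16 * e k.
  have [sP pP Pmin Pmax] := Pbd k.+1 isT; have [HE xE] := hb k.
  have b01 : 0 <= beta <= 1 / 2 by lra.
  have := lyapunov_step L_gt0 pmin_gt0 pmin_lt_pmax df Lf b01 a0 La sP pP
    Pmin Pmax HE xE.
  by rewrite /F /e /c /G /sqn; lra.
have decay : forall k, F k + e k <= (F 0 + e 0) * r ^+ k /\
    c * G k <= (F 0 + e 0) * r ^+ k.
  apply: (@lyapunov_contraction _ F G e c mu r) => //.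
  - by rewrite le_max lexx orbT.
  - by move=> k; rewrite /G /sqn -frob_norm_sqr; exact: PL.
have V0 : 0 <= F 0 + e 0 by rewrite addr_ge0.
split.
  apply: (@geometric_sqr_cvg0 _ _ (c^-1 * (F 0 + e 0)) r).
    by rewrite r1 andbT; lra.
  move=> k; rewrite frob_norm_sqr -mulrA -/(G k) ler_pdivlMl //.
  by have [] := decay k.
(* The initial pair may be at a minimiser with no momentum error, hence [+ 1]. *)
exists (F 0 + e 0 + 1), r; split; [lra | by rewrite r1 andbT; lra | ].
move=> k; rewrite mulrDl mul1r; have [+ _] := decay k; have := e0 k.
have : 0 <= r ^+ k by apply: exprn_ge0; lra.
by rewrite /F; lra.
Qed.
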